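(* Let $n\ge 1$ and let $\mathbb{F}_q$ be a finite field. The collection of all cluster characters of $U(n,\mathbb{F}_q)$ forms an orthogonal basis for the $\mathbb{C}$-linear space of cluster functions on $U(n,\mathbb{F}_q)$.
   Context: $U(n,\mathbb{F}_q)$ is the group of upper triangular unipotent $n\times n$ matrices over $\mathbb{F}_q$, $\mathfrak{u}(n,\mathbb{F}_q)$ is the algebra of upper triangular nilpotent (strictly upper triangular) matrices, and $\mathfrak{u}^*(n,\mathbb{F}_q)$ is its $\mathbb{F}_q$-linear dual. The adjoint cluster of $X\in\mathfrak{u}(n,\mathbb{F}_q)$ is $K(X)=\{gXg' : g,g'\in U(n,\mathbb{F}_q)\}$; a conjugacy cluster in $U(n,\mathbb{F}_q)$ is a set of the form $I+K(X)$. A cluster function is a complex-valued function on $U(n,\mathbb{F}_q)$ that is constant on each conjugacy cluster. For $g\in U(n,\mathbb{F}_q)$ and $\lambda\in\mathfrak{u}^*(n,\mathbb{F}_q)$ define $(g*\lambda)(X)=\lambda(Xg)$ (left action). Fix a non-trivial homomorphism $\theta$ from the additive group of $\mathbb{F}_q$ to the multiplicative group $\mathbb{C}^\times$. Let $\mathbb{C}[U(n,\mathbb{F}_q)]$ be the space of complex-valued functions on $U(n,\mathbb{F}_q)$, carrying the regular representation $(g*v)(g')=v(g'g)$, and put $v(\lambda)(g)=\theta[\lambda(g-I)]$. For $\lambda\in\mathfrak{u}^*(n,\mathbb{F}_q)$, the span $V(\lambda)$ of $\{v(\mu): \mu=g*\lambda,\ g\in U(n,\mathbb{F}_q)\}$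 is a submodule of the regular representation, called a cluster module; its character $\chi(\lambda)$ is called a cluster character. Orthogonality is with respect to $\langle f,h\rangle=\frac{1}{|U(n,\mathbb{F}_q)|}\sum_{g\in U(n,\mathbb{F}_q)}f(g)\overline{h(g)}$. *)

(* Defs.v *)
From HB Require Import structures.
From mathcomp Require Import all_boot all_order all_algebra all_fingroup all_field.
From mathcomp Require Import reals.
From mathcomp Require Export complex.

Set Implicit Arguments.
Unset Strict Implicit.
Unset Printing Implicit Defensive.

Import GRing.Theory Num.Theory.
Local Open Scope ring_scope.
Local Open Scope complex_scope.

Section UnipotentGroup.

Variables (F : finFieldType) (n : nat).
Implicit Types (A B : 'M[F]_n) (i j : 'I_n).

Definition unitriangular A : bool :=
  [forall i : 'I_n, forall j : 'I_n, (j <= i)%N ==> (A i j == (i == j)%:R)].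

Lemma unitriangularP A :
  reflect (forall i j : 'I_n, (j <= i)%N -> A i j = (i == j)%:R) (unitriangular A).
Proof.
apply: (iffP forallP) => [H i j ji | H i].
  by have /forallP/(_ j)/implyP/(_ ji)/eqP := H i.
by apply/forallP=> j; apply/implyP=> ji; rewrite H.
Qed.

Lemma unitriangular1 : unitriangular 1%:M.
Proof. by apply/unitriangularP=> i j _; rewrite mxE. Qed.

Lemma unitriangularM A B :
  unitriangular A -> unitriangular B -> unitriangular (A *m B).
Proof.
move=> /unitriangularP HA /unitriangularP HB; apply/unitriangularP=> i j ji.
have E k : A i k * B k j = if k == i then (i == j)%:R else 0.
  have [->|neq_ki] := eqVneq k i; first by rewrite HA ?leqnn // eqxx mul1r HB.
  have [ki|ik] := leqP k i.
    by rewrite HA // eq_sym (negPf neq_ki) mul0r.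
  have jk := leq_ltn_trans ji ik.
  rewrite (HB k j (ltnW jk)); have [kj|_] := eqVneq k j; last by rewrite mulr0.
  by rewrite kj ltnn in jk.
by rewrite mxE (eq_bigr _ (fun k _ => E k)) -big_mkcond big_pred1_eq.
Qed.

Lemma unitriangular_unit A : unitriangular A -> A \in unitmx.
Proof.
move=> /unitriangularP HA; rewrite -unitmx_tr unitmxE det_trig.
  by rewrite big1 ?unitr1 // => i _; rewrite mxE HA // eqxx.
apply/is_trig_mxP=> i j ij; rewrite mxE HA ?(ltnW ij) //.
by case: eqVneq ij => // ->; rewrite ltnn.
Qed.

Lemma unitriangularV A : unitriangular A -> unitriangular (invmx A).
Proof.
move=> UA; have Au := unitriangular_unit UA.
pose S := [set B : 'M[F]_n | unitriangular B].
have inj : {in S &, injective (mulmx A)}.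
  by move=> B C _ _ /(congr1 (mulmx (invmx A))); rewrite !mulKmx.
have sub : mulmx A @: S \subset S.
  by apply/subsetP=> _ /imsetP[B + ->]; rewrite !inE; apply: unitriangularM.
have /eqP im : mulmx A @: S == S by rewrite eqEcard sub card_in_imset //=.
have : 1%:M \in S by rewrite inE unitriangular1.
rewrite -im => /imsetP[B]; rewrite inE => UB E.
by rewrite -[invmx A]mulmx1 E mulKmx.
Qed.

Record unitri : predArgType :=
  Unitri { unitri_mx :> 'M[F]_n; _ : unitriangular unitri_mx }.

HB.instance Definition _ := [isSub for unitri_mx].
HB.instance Definition _ := [Finite of unitri by <:].

Implicit Types g h : unitri.

Lemma unitri_mxP g : unitriangular g.
Proof. exact: valP. Qed.

Definition unitri_one : unitri := Unitri unitriangular1.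
Definition unitri_mul g h : unitri :=
  Unitri (unitriangularM (unitri_mxP g) (unitri_mxP h)).
Definition unitri_inv g : unitri := Unitri (unitriangularV (unitri_mxP g)).

Fact unitri_mulA : associative unitri_mul.
Proof. by move=> g h k; apply/val_inj; rewrite /= mulmxA. Qed.
Fact unitri_mul1 : left_id unitri_one unitri_mul.
Proof. by move=> g; apply/val_inj; rewrite /= mul1mx. Qed.
Fact unitri_mulV : left_inverse unitri_one unitri_inv unitri_mul.
Proof.
by move=> g; apply/val_inj; rewrite /= mulVmx ?unitriangular_unit ?unitri_mxP.
Qed.

HB.instance Definition _ :=
  Finite_isGroup.Build unitri unitri_mulA unitri_mul1 unitri_mulV.

Lemma unitri_mxM g h : (g * h)%g = (g : 'M_n) *m h :> 'M_n.
Proof. by []. Qed.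

Lemma unitri_mx1 : (1%g : unitri) = 1%:M :> 'M_n.
Proof. by []. Qed.

Definition lower_part A : 'M[F]_n := \matrix_(i, j) (A i j *+ (j <= i)%N).

Fact lower_part_is_linear : linear lower_part.
Proof.
by move=> a A B; apply/matrixP=> i j; rewrite !mxE mulrnDl mulrnAr.
Qed.
HB.instance Definition _ :=
  GRing.isLinear.Build F 'M[F]_n 'M[F]_n _ lower_part lower_part_is_linear.

Definition strict_upper_space : {vspace 'M[F]_n} := lker (linfun lower_part).

Lemma strict_upper_spaceP A :
  reflect (forall i j : 'I_n, (j <= i)%N -> A i j = 0) (A \in strict_upper_space).
Proof.
rewrite memv_ker lfunE; apply: (iffP eqP) => [/matrixP H i j ji | H].
  by have := H i j; rewrite !mxE ji.
apply/matrixP=> i j; rewrite !mxE; case: leqP => [ji|]; last by rewrite mulr0n.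
by rewrite H.
Qed.

Definition strict_upper : Type := subvs_of strict_upper_space.
HB.instance Definition _ := Vector.on strict_upper.

Lemma strict_upper_mulr_proof g (X : strict_upper) :
  vsval X *m g \in strict_upper_space.
Proof.
have /strict_upper_spaceP HX : vsval X \in strict_upper_space by exact: valP.
have /unitriangularP Hg := unitri_mxP g.
apply/strict_upper_spaceP=> i j ji; rewrite mxE big1 // => k _.
have [ki|ik] := leqP k i; first by rewrite HX ?mul0r.
have jk := leq_ltn_trans ji ik.
rewrite Hg ?(ltnW jk) //; case: eqVneq jk => [->|_ _]; first by rewrite ltnn.
by rewrite mulr0.
Qed.

Definition strict_upper_mulr g (X : strict_upper) : strict_upper :=
  Subvs (strict_upper_mulr_proof g X).

Fact strict_upper_mulr_is_linear g : linear (strict_upper_mulr g).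
Proof.
by move=> a X Y; apply/val_inj; rewrite /= mulmxDl -scalemxAl.
Qed.
HB.instance Definition _ g :=
  GRing.isLinear.Build F strict_upper strict_upper _ (strict_upper_mulr g)
    (strict_upper_mulr_is_linear g).

Lemma unitri_sub1_proof g : unitri_mx g - 1%:M \in strict_upper_space.
Proof.
have /unitriangularP Hg := unitri_mxP g.
by apply/strict_upper_spaceP=> i j ji; rewrite !mxE Hg // subrr.
Qed.

Definition unitri_sub1 g : strict_upper := Subvs (unitri_sub1_proof g).

Definition adjoint_cluster (X : strict_upper) : {set 'M[F]_n} :=
  [set (g : 'M[F]_n) *m vsval X *m (g' : 'M[F]_n) | g : unitri, g' : unitri].

(* I + K(X), as a subset of the group. *)
Definition conjugacy_cluster (X : strict_upper) : {set unitri} :=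
  [set h : unitri | unitri_mx h \in [set 1%:M + Y | Y in adjoint_cluster X]].

(* [finvect_type] equips the finite vector space of linear forms with its
   finType structure. *)
Definition linear_dual : predArgType := finvect_type 'Hom(strict_upper, F^o).

Implicit Types lam : 'Hom(strict_upper, F^o).

Definition dual_act g lam : 'Hom(strict_upper, F^o) :=
  (lam \o linfun (strict_upper_mulr g))%VF.

Lemma dual_actE g lam X : dual_act g lam X = lam (strict_upper_mulr g X).
Proof. by rewrite comp_lfunE lfunE. Qed.

End UnipotentGroup.

(* Matrix coefficients are taken in the basis [vbasis V]; this is the trace of
   the restriction of [f] to [V] when [f] is linear and stabilizes [V]. *)
Definition trace_on (K : fieldType) (vT : vectType K) (V : {vspace vT})
    (f : vT -> vT) : K :=
  \tr (\matrix_(i < \dim V, j < \dim V)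
         coord (vbasis V) j (f (vbasis V)`_i)).

Section ClusterCharacters.

Variables (F : finFieldType) (n : nat) (R : realType).

Definition group_algebra : Type := {ffun unitri F n -> R[i]^o}.
HB.instance Definition _ := Vector.on group_algebra.

Implicit Types (f h v : group_algebra) (lam : 'Hom(strict_upper F n, F^o)).

Definition regular_act (g : unitri F n) v : group_algebra :=
  [ffun g' : unitri F n => v (g' * g)%g].

Definition evaluation_diff (x y : unitri F n) (f : group_algebra) : R[i]^o :=
  f x - f y.
Fact evaluation_diff_is_linear x y : linear (evaluation_diff x y).
Proof.
move=> a f h; rewrite /evaluation_diff !ffunE.
by rewrite scalerBr opprD addrACA.
Qed.
HB.instance Definition _ x y :=
  GRing.isLinear.Build R[i] group_algebra R[i]^o _
    (evaluation_diff x y) (evaluation_diff_is_linear x y).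

Definition cluster_functions : {vspace group_algebra} :=
  (\bigcap_(X : finvect_type (strict_upper F n))
     \bigcap_(x in conjugacy_cluster X)
       \bigcap_(y in conjugacy_cluster X)
         lker (linfun (evaluation_diff x y)))%VS.

Lemma cluster_functionsP f :
  reflect (forall X : strict_upper F n,
             {in conjugacy_cluster X &, forall x y, f x = f y})
          (f \in cluster_functions).
Proof.
have kerE x y : (f \in lker (linfun (evaluation_diff x y))) = (f x == f y).
  by rewrite memv_ker lfunE /= /evaluation_diff subr_eq0.
apply: (iffP idP) => [Hf X x y Xx Xy | Hf].
  apply/eqP; rewrite -kerE; move: f Hf {kerE}; apply/subvP.
  apply: (bigcapv_inf (X : finvect_type _)) => //.
  by apply: (bigcapv_inf x) => //; apply: (bigcapv_inf y).
rewrite memvE; apply/subv_bigcapP=> X _.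
apply/subv_bigcapP=> x Xx; apply/subv_bigcapP=> y Xy.
by rewrite -memvE kerE; apply/eqP/(Hf X).
Qed.

Definition inner_product f h : R[i] :=
  #|[set: unitri F n]|%:R^-1 *
    \sum_(g : unitri F n) (f g : R[i]) * ((h g : R[i])^*)%R.

Variable theta : F -> R[i].

Definition cluster_vector lam : group_algebra :=
  [ffun g : unitri F n => theta (lam (unitri_sub1 g))].

Definition cluster_module lam : {vspace group_algebra} :=
  <<[seq cluster_vector (dual_act g lam) | g : unitri F n]>>%VS.

Definition cluster_character lam : group_algebra :=
  [ffun g : unitri F n => trace_on (cluster_module lam) (regular_act g)].

(* Forms in the same orbit have the same character, listed once. *)
Definition cluster_characters : seq group_algebra :=
  undup [seq cluster_character lam | lam : linear_dual F n].

Lemma cluster_charactersP f :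
  reflect (exists lam, f = cluster_character lam) (f \in cluster_characters).
Proof.
rewrite mem_undup; apply: (iffP mapP) => [[lam _ ->] | [lam ->]].
  by exists lam.
by exists lam; rewrite ?mem_enum.
Qed.

Lemma regular_act_cluster_vector g lam :
  {morph theta : x y / x + y >-> x * y} ->
  regular_act g (cluster_vector lam) =
    theta (lam (unitri_sub1 g)) *: cluster_vector (dual_act g lam).
Proof.
move=> thetaD; apply/ffunP=> x; rewrite !ffunE dual_actE.
have -> : unitri_sub1 (x * g)%g
          = unitri_sub1 g + strict_upper_mulr g (unitri_sub1 x).
  by apply/val_inj; rewrite /= mulmxBl mul1mx [RHS]addrC addrA subrK.
by rewrite linearD thetaD.
Qed.

Lemma cluster_module_stable g lam v :
  {morph theta : x y / x + y >-> x * y} ->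
  v \in cluster_module lam -> regular_act g v \in cluster_module lam.
Proof.
rewrite /cluster_module => thetaD; set s := [seq _ | _ : _].
pose b := in_tuple s.
move=> /(@coord_span _ _ _ b) ->.
have -> : regular_act g (\sum_i coord b i v *: b`_i)
          = \sum_i coord b i v *: regular_act g b`_i.
  apply/ffunP=> x; rewrite ffunE !sum_ffunE.
  by apply: eq_bigr => i _; rewrite !ffunE.
apply: memv_suml => i _; apply: memvZ.
have /mapP[k _ ->] : b`_i \in b by exact: mem_nth.
rewrite regular_act_cluster_vector //; apply/memvZ/memv_span/mapP.
exists (g * k)%g; first by rewrite mem_enum.
congr cluster_vector; apply/lfunP=> X; rewrite !dual_actE.
by congr (lam _); apply/val_inj; rewrite /= mulmxA.
Qed.

End ClusterCharacters.

(* Main.v *)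
Require Import Defs.
From mathcomp Require Import all_boot all_order all_algebra all_fingroup all_field.
From mathcomp Require Import reals.
From HB Require Import structures.
From mathcomp Require Import ring.

(** Write A for the algebra of strictly upper triangular matrices and
G = 1 + A for the group.  The matrix coefficients v(mu), for mu a linear form
on A, are the functions 1 + X |-> theta (mu X), that is, the characters of the
finite abelian group A; they are orthonormal and, by counting, a basis of all
functions on G.  Since x acts by v(mu) |-> theta (mu (x - 1)) v(x mu), the
v(mu) with mu in the orbit G lam form a basis of the cluster module that x
permutes up to scalars, and the trace only sees the fixed points:
  chi(lam)(x) = sum of theta (mu (x - 1)) over the mu in G lam with x mu = mu.

The key remark is that the condition x mu = mu is detected by averaging over
left multiplications.  With X = x - 1, an element h = 1 + Y of G gives
  theta (mu (h X)) = theta (mu X) * theta ((x mu - mu) Y),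
and the sum over Y vanishes unless x mu = mu ([sum_theta_mull]).  Hence, up to
an explicit positive factor, chi(lam) is the sum of theta (lam (h X g)) over
all h and g in G ([biorbit_sumE]).

All the claims are read off this formula.  It is invariant under X |-> g X h,
so chi(lam) is a cluster function.  It is a combination of the v(mu) with mu in
the two-sided orbit of lam, so forms from different two-sided orbits have
orthogonal characters, while forms from the same one have equal characters,
the positive factor being the same.  Finally, averaging over X |-> g X h fixes
the cluster functions up to a scalar and sends each v(mu) to a multiple of
chi(mu); as the v(mu) span everything, the cluster characters span the cluster
functions ([cluster_function_span]). *)

Set Implicit Arguments.
Unset Strict Implicit.
Unset Printing Implicit Defensive.

Local Open Scope ring_scope.
Local Open Scope complex_scope.

Import GRing.Theory Num.Theory.

(** * Traces in an arbitrary basis *)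

Section TraceInABasis.

Variables (K : fieldType) (vT : vectType K) (V : {vspace vT}).
Variable f : {linear vT -> vT}.

(** The change of basis is written with rectangular matrices P and Q, so that
the length m of the new basis need not be identified with the dimension of V:
cyclicity of the trace turns tr (P M Q) into tr (M Q P), and Q P = 1. *)
Lemma trace_on_basis m (e : m.-tuple vT) :
  basis_of V e -> (forall v, v \in V -> f v \in V) ->
  trace_on V f = \sum_(i < m) coord e i (f e`_i).
Proof.
move=> eV fV; set b := vbasis V.
have bV : basis_of V b by exact: vbasisP.
pose P := \matrix_(i < \dim V, j < m) coord e j b`_i.
pose Q := \matrix_(i < m, j < \dim V) coord b j e`_i.
pose M := \matrix_(i < m, j < m) coord e j (f e`_i).
have eK v : v \in V -> v = \sum_i coord e i v *: e`_i.
  by move=> vV; apply: coord_span; rewrite (span_basis eV).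
have bK v : v \in V -> v = \sum_i coord b i v *: b`_i.
  by move=> vV; apply: coord_span; rewrite (span_basis bV).
have eIn (i : 'I_m) : e`_i \in V.
  by apply: (basis_mem eV); rewrite mem_nth ?size_tuple ?ltn_ord.
have bIn (i : 'I_(\dim V)) : b`_i \in V.
  by apply: (basis_mem bV); rewrite mem_nth ?size_tuple ?ltn_ord.
have QP : Q *m P = 1%:M.
  apply/matrixP=> i j; rewrite !mxE -(coord_free _ _ (basis_free eV)).
  rewrite [in RHS](bK _ (eIn i)) linear_sum; apply: eq_bigr => k _.
  by rewrite linearZ !mxE.
have -> : trace_on V f = \tr (P *m M *m Q).
  congr (\tr _); apply/matrixP=> i j; rewrite !mxE.
  rewrite {1}(eK _ (bIn i)) !linear_sum.
  under [RHS]eq_bigr do rewrite mxE big_distrl.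
  rewrite exchange_big; apply: eq_bigr => k _ /=.
  rewrite !linearZ /= {1}(eK _ (fV _ (eIn k))) linear_sum mulr_sumr.
  by apply: eq_bigr => l _; rewrite linearZ !mxE -mulrA.
rewrite -mulmxA mxtrace_mulC -mulmxA QP mulmx1.
by apply: eq_bigr => i _; rewrite mxE.
Qed.

End TraceInABasis.

(** * Additive characters of a finite field *)

Section AdditiveCharacter.

Variables (F : finFieldType) (R : realType) (theta : F -> R[i]).
Hypothesis thetaD : forall x y : F, theta (x + y) = theta x * theta y.
Hypothesis theta_neq0 : forall x : F, theta x != 0.
Hypothesis theta_nontrivial : exists x : F, theta x != 1.

Lemma theta0 : theta 0 = 1.
Proof. by apply: (mulfI (theta_neq0 0)); rewrite -thetaD addr0 mulr1. Qed.

Lemma theta_mulrn x k : theta (x *+ k) = theta x ^+ k.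
Proof. by elim: k => [|k IHk]; rewrite ?theta0 // mulrS thetaD IHk exprS. Qed.

(** The values of theta are roots of unity, of order dividing the
characteristic, so conjugation is inversion. *)
Lemma conj_theta x : ((theta x)^*)%R = theta (- x).
Proof.
have [p p_pr charFp] := finPcharP F.
have /eqP : `|theta x| ^+ p = 1.
  by rewrite -normrX -theta_mulrn (mulrn_pchar charFp) theta0 normr1.
rewrite pexpr_eq1 ?prime_gt0 // => /eqP norm1.
apply: (mulfI (theta_neq0 x)).
by rewrite -normCK norm1 expr1n -thetaD subrr theta0.
Qed.

(** A nonzero linear form is onto the field, so some translation multiplies the
sum by a value of theta other than 1. *)
Lemma sum_theta_linear (W : vectType F) (l : {linear W -> F^o}) w0 :
  l w0 != 0 -> \sum_(w : finvect_type W) theta (l w) = 0.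
Proof.
move=> lw0; have [x thx] := theta_nontrivial.
pose w1 : finvect_type W := ((x / l w0) *: w0)%R.
have lw1 : l w1 = x by rewrite linearZ /= -[RHS](divfK lw0).
set S := (X in X = 0).
have : theta x * S = S.
  rewrite /S [RHS](reindex_inj (addrI w1)) mulr_sumr.
  by apply: eq_bigr => w _; rewrite /= linearD thetaD lw1.
move/eqP; rewrite -subr_eq0 -{2}[S]mul1r -mulrBl mulf_eq0 subr_eq0.
by rewrite (negPf thx) => /eqP.
Qed.

End AdditiveCharacter.

(** * Two-sided action on the dual *)

Section BiAction.

Variables (F : finFieldType) (n : nat).
Implicit Types (g h : unitri F n) (X : strict_upper F n).
Implicit Types lam mu : 'Hom(strict_upper F n, F^o).

Lemma strict_upper_mull_proof g X :
  (g : 'M[F]_n) *m vsval X \in strict_upper_space F n.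
Proof.
have /strict_upper_spaceP HX : vsval X \in strict_upper_space F n.
  exact: valP.
have /unitriangularP Hg := unitri_mxP g.
apply/strict_upper_spaceP=> i j ji; rewrite mxE big1 // => k _.
have [jk|kj] := leqP j k; first by rewrite HX ?mulr0.
have ki := leq_trans kj ji.
rewrite Hg ?(ltnW ki) //; case: eqVneq ki => [->|_ _]; first by rewrite ltnn.
by rewrite mul0r.
Qed.

Definition strict_upper_mull g X : strict_upper F n :=
  Subvs (strict_upper_mull_proof g X).

Fact strict_upper_mull_is_linear g : linear (strict_upper_mull g).
Proof. by move=> a X Y; apply/val_inj; rewrite /= mulmxDr -scalemxAr. Qed.
HB.instance Definition _ g :=
  GRing.isLinear.Build F (strict_upper F n) (strict_upper F n) _
    (strict_upper_mull g) (strict_upper_mull_is_linear g).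

(** Precomposing with left multiplication commutes with [dual_act], but is
contravariant: g acts on the right and h on the left. *)
Definition bidual_act g h lam : 'Hom(strict_upper F n, F^o) :=
  (dual_act h lam \o linfun (strict_upper_mull g))%VF.

Lemma bidual_actE g h lam X :
  bidual_act g h lam X = lam (strict_upper_mulr h (strict_upper_mull g X)).
Proof. by rewrite comp_lfunE dual_actE lfunE. Qed.

Lemma dual_actM g h lam : dual_act g (dual_act h lam) = dual_act (g * h)%g lam.
Proof.
apply/lfunP=> X; rewrite !dual_actE; congr (lam _); apply/val_inj.
by rewrite /= mulmxA.
Qed.

Lemma dual_act1 lam : dual_act 1%g lam = lam.
Proof.
apply/lfunP=> X; rewrite !dual_actE; congr (lam _); apply/val_inj.
by rewrite /= mulmx1.
Qed.

Lemma bidual_actM g g' h h' lam :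
  bidual_act g h (bidual_act g' h' lam) = bidual_act (g' * g)%g (h * h')%g lam.
Proof.
apply/lfunP=> X; rewrite !bidual_actE; congr (lam _); apply/val_inj.
by rewrite /= !mulmxA.
Qed.

Lemma bidual_act1 lam : bidual_act 1%g 1%g lam = lam.
Proof.
apply/lfunP=> X; rewrite bidual_actE; congr (lam _); apply/val_inj.
by rewrite /= mul1mx mulmx1.
Qed.

Lemma unitri_add1_proof X : unitriangular (1%:M + vsval X : 'M[F]_n).
Proof.
have /strict_upper_spaceP HX : vsval X \in strict_upper_space F n.
  exact: valP.
by apply/unitriangularP=> i j ji; rewrite !mxE HX // addr0.
Qed.

Definition unitri_add1 X : unitri F n := Unitri (unitri_add1_proof X).

Lemma unitri_sub1K : cancel (@unitri_sub1 F n) unitri_add1.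
Proof. by move=> g; apply/val_inj; rewrite /= addrC subrK. Qed.

Lemma unitri_add1K : cancel unitri_add1 (@unitri_sub1 F n).
Proof. by move=> X; apply/val_inj; rewrite /= addrC addKr. Qed.

Lemma sum_unitri (T : nmodType) (G : strict_upper F n -> T) :
  \sum_(g : unitri F n) G (unitri_sub1 g) =
  \sum_(X : finvect_type (strict_upper F n)) G X.
Proof.
rewrite [RHS](reindex
  (fun g : unitri F n => unitri_sub1 g : finvect_type (strict_upper F n))) //=.
by exists unitri_add1 => ? _; rewrite ?unitri_sub1K ?unitri_add1K.
Qed.

(** The group and the dual of its algebra have the same cardinality because a
finite vector space and its dual do; this is what makes the functions attached
to linear forms numerous enough to span. *)
Lemma card_unitri : #|unitri F n| = #|linear_dual F n|.
Proof.
have -> : #|unitri F n| = #|finvect_type (strict_upper F n)|.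
  apply: (@bij_eq_card _ (finvect_type (strict_upper F n)) (@unitri_sub1 F n)).
  by exists unitri_add1; [exact: unitri_sub1K | exact: unitri_add1K].
have cardE (W : vectType F) : #|finvect_type W| = (#|F| ^ dim W)%N.
  rewrite -(card_vspacef (Vector.class (finvect_type W))) card_vspace.
  by rewrite dimvf.
rewrite [LHS]cardE [RHS]cardE; congr (_ ^ _)%N.
rewrite [RHS]/dim /=.
by rewrite muln1.
Qed.

Definition dual_orbit lam : {set linear_dual F n} :=
  [set (dual_act g lam : linear_dual F n) | g : unitri F n].

Definition dual_stab lam : {set unitri F n} := [set g | dual_act g lam == lam].

(** The orbit map is constant exactly on the left cosets of the stabilizer. *)
Lemma sum_dual_orbit (T : nmodType)
    (G : 'Hom(strict_upper F n, F^o) -> T) lam :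
  \sum_(g : unitri F n) G (dual_act g lam) =
  (\sum_(mu in dual_orbit lam) G mu) *+ #|dual_stab lam|.
Proof.
rewrite (partition_big (fun g => dual_act g lam : linear_dual F n)
  (mem (dual_orbit lam))) /=; last by move=> g _; apply: imset_f.
rewrite -sumrMnl; apply: eq_bigr => _ /imsetP[k _ ->].
rewrite (eq_bigr (fun=> G (dual_act k lam))) => [|g /eqP -> //].
rewrite (eq_bigl (mem [set (k * h)%g | h in dual_stab lam])) => [|g /=].
  by rewrite sumr_const card_imset //; apply: mulgI.
apply/eqP/imsetP => [E | [h]].
  exists (k^-1 * g)%g; last by rewrite mulKVg.
  (* E is an equation in the finite copy of the dual; the cast puts it back
     in the space of linear forms. *)
  by rewrite inE -dual_actM (E : dual_act g lam = _) dual_actM mulVg dual_act1.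
by rewrite inE => /eqP E ->; rewrite -dual_actM E.
Qed.

Lemma dual_act_bidual g lam : dual_act g lam = bidual_act 1%g g lam.
Proof.
apply/lfunP=> X; rewrite dual_actE bidual_actE; congr (lam _); apply/val_inj.
by rewrite /= mul1mx.
Qed.

(** Left multiplications commute with [dual_act] and leave the stabilizer
unchanged, while moving inside the orbit conjugates it. *)
Lemma card_dual_stab_bidual g h lam :
  #|dual_stab (bidual_act g h lam)| = #|dual_stab lam|.
Proof.
rewrite -(cardJg (dual_stab lam) h^-1%g); apply: eq_card => k.
rewrite mem_conjgV !inE !dual_act_bidual bidual_actM mulg1.
have bK : cancel (bidual_act g h) (bidual_act g^-1%g h^-1%g).
  by move=> mu; rewrite bidual_actM mulgV mulVg bidual_act1.
have bK' : cancel (bidual_act g^-1%g h^-1%g) (bidual_act g h).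
  by move=> mu; rewrite bidual_actM mulVg mulgV bidual_act1.
by rewrite -(can_eq bK') bK bidual_actM mulgV.
Qed.

End BiAction.

(** * The inner product on functions *)

Section InnerProduct.

Variables (F : finFieldType) (n : nat) (R : realType).
Implicit Types f h : group_algebra F n R.

Lemma inner_productZl a f h : inner_product (a *: f) h = a * inner_product f h.
Proof.
rewrite /inner_product [RHS]mulrCA; congr (_ * _); rewrite mulr_sumr.
by apply: eq_bigr => g _; rewrite !ffunE /= mulrA.
Qed.

Lemma inner_product0l h : inner_product 0 h = 0.
Proof. by rewrite -(scale0r h) inner_productZl mul0r. Qed.

Lemma inner_productC f h : inner_product h f = ((inner_product f h)^*)%R.
Proof.
rewrite /inner_product rmorphM rmorph_sum /= fmorphV rmorph_nat; congr (_ * _).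
by apply: eq_bigr => g _; rewrite rmorphM /= conjCK mulrC.
Qed.

Lemma inner_product_suml I (r : seq I) (P : pred I)
    (G : I -> group_algebra F n R) h :
  inner_product (\sum_(i <- r | P i) G i) h =
  \sum_(i <- r | P i) inner_product (G i) h.
Proof.
rewrite /inner_product -mulr_sumr; congr (_ * _); rewrite exchange_big.
by apply: eq_bigr => g _; rewrite sum_ffunE mulr_suml.
Qed.

Lemma inner_productZr a f h :
  inner_product f (a *: h) = (a^*)%R * inner_product f h.
Proof.
rewrite inner_productC inner_productZl rmorphM; congr (_ * _).
exact/esym/inner_productC.
Qed.

Lemma inner_product_sumr I (r : seq I) (P : pred I)
    (G : I -> group_algebra F n R) h :
  inner_product h (\sum_(i <- r | P i) G i) =
  \sum_(i <- r | P i) inner_product h (G i).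
Proof.
rewrite inner_productC inner_product_suml rmorph_sum.
by apply: eq_bigr => i _; apply/esym/inner_productC.
Qed.

Lemma card_unitri_neq0 : #|[set: unitri F n]|%:R != 0 :> R[i].
Proof. by rewrite pnatr_eq0 -lt0n cardsT; apply/card_gt0P; exists 1%g. Qed.

Lemma inner_product_eq0 f : inner_product f f = 0 -> f = 0.
Proof.
move/eqP; rewrite mulf_eq0 invr_eq0 (negPf card_unitri_neq0) /=.
rewrite psumr_eq0 => [/allP f0|g _]; last exact: mul_conjC_ge0.
apply/ffunP=> g; rewrite ffunE.
by have := f0 g; rewrite mem_index_enum mul_conjC_eq0 => /(_ isT)/eqP.
Qed.

Lemma orthogonal_free (s : seq (group_algebra F n R)) :
  uniq s -> 0 \notin s ->
  {in s &, forall f h, f != h -> inner_product f h = 0} -> free s.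
Proof.
move=> us s0 orth; apply/(@freeP _ _ _ (in_tuple s)) => k sum0 i.
have si (j : 'I_(size s)) : s`_j \in s by apply: mem_nth.
have := inner_product_suml (index_enum _) xpredT
  (fun j : 'I_(size s) => k j *: s`_j) s`_i.
rewrite sum0 (bigD1 i) //= big1 => [|j ji]; last first.
  by rewrite inner_productZl orth ?mulr0 // nth_uniq.
rewrite addr0 inner_product0l inner_productZl => /esym/eqP.
rewrite mulf_eq0 => /orP[/eqP //|].
move/eqP/inner_product_eq0 => si0.
by have := si i; rewrite si0 (negPf s0).
Qed.

Fact regular_act_is_linear (g : unitri F n) : linear (@regular_act F n R g).
Proof. by move=> a f h; apply/ffunP=> x; rewrite !ffunE. Qed.
HB.instance Definition _ g :=
  GRing.isLinear.Build R[i] (group_algebra F n R) (group_algebra F n R) _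
    (@regular_act F n R g) (regular_act_is_linear g).

End InnerProduct.

(** * Cluster characters *)

Section ClusterCharacterTheory.

Variables (R : realType) (F : finFieldType) (n : nat) (theta : F -> R[i]).
Hypothesis thetaD : forall x y : F, theta (x + y) = theta x * theta y.
Hypothesis theta_neq0 : forall x : F, theta x != 0.
Hypothesis theta_nontrivial : exists x : F, theta x != 1.

Implicit Types (g h x : unitri F n) (X : strict_upper F n).
Implicit Types lam mu : 'Hom(strict_upper F n, F^o).

Lemma sum_theta_form lam :
  \sum_(g : unitri F n) theta (lam (unitri_sub1 g)) =
  #|[set: unitri F n]|%:R * (lam == 0)%:R.
Proof.
have [-> | lam0] := eqVneq lam 0.
  under eq_bigr do rewrite lfunE /= (theta0 thetaD theta_neq0).
  by rewrite sumr_const mulr1 cardsT.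
rewrite mulr0 (sum_unitri (fun X => theta (lam X))).
have [X lamX | all0] :=
  pickP (fun X : finvect_type (strict_upper F n) => lam X != 0).
  exact: sum_theta_linear lamX.
case/eqP: lam0; apply/lfunP=> X; rewrite [RHS]lfunE /=.
by apply/eqP; have /negbFE := all0 X.
Qed.

Lemma inner_product_cluster_vector lam mu :
  inner_product (cluster_vector theta lam) (cluster_vector theta mu) =
  (lam == mu)%:R.
Proof.
rewrite /inner_product.
rewrite (eq_bigr (fun g => theta ((lam - mu) (unitri_sub1 g)))) => [|g _].
  by rewrite sum_theta_form mulrA mulVf ?card_unitri_neq0 // mul1r subr_eq0.
by rewrite !ffunE (conj_theta thetaD theta_neq0) -thetaD add_lfunE opp_lfunE.
Qed.

Lemma cluster_vector_inj :
  injective (cluster_vector theta : linear_dual F n -> _).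
Proof.
move=> lam mu E; have /eqP := inner_product_cluster_vector lam mu.
rewrite E inner_product_cluster_vector eqxx eq_sym pnatr_eq1 eqb1.
by move/eqP.
Qed.

Lemma cluster_vectors_free (s : seq (linear_dual F n)) :
  uniq s -> free [seq cluster_vector theta lam | lam <- s].
Proof.
move=> us; apply: orthogonal_free.
- by rewrite (map_inj_uniq cluster_vector_inj).
- apply/mapP=> -[lam _ E]; have := inner_product_cluster_vector lam lam.
  rewrite -E inner_product0l eqxx.
  by move/esym/eqP; rewrite oner_eq0.
move=> _ _ /mapP[lam _ ->] /mapP[mu _ ->] neq.
rewrite inner_product_cluster_vector; case: eqVneq => // E.
by rewrite E eqxx in neq.
Qed.

Lemma cluster_module_basis lam :
  basis_of (cluster_module theta lam)
    [seq cluster_vector theta mu | mu <- enum (dual_orbit lam)].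
Proof.
rewrite /basis_of cluster_vectors_free ?enum_uniq // andbT.
apply/eqP/eq_span => v.
apply/imageP/imageP => [[_ /imsetP[g _ ->] ->] | [g _ ->]]; first by exists g.
by exists (dual_act g lam : linear_dual F n); first exact: imset_f.
Qed.

(** In the basis of the orbit, x acts by a permutation matrix with scalars, so
only the forms fixed by x contribute to the trace. *)
Lemma cluster_character_orbit lam x :
  cluster_character theta lam x =
  \sum_(mu in dual_orbit lam)
    (dual_act x mu == mu)%:R * theta (mu (unitri_sub1 x)).
Proof.
set O := dual_orbit lam.
pose e := map_tuple (cluster_vector theta) (enum_tuple O).
have e_basis : basis_of (cluster_module theta lam) e :=
  cluster_module_basis lam.
have eE (i : 'I_#|O|) : e`_i = cluster_vector theta (enum_val i).
  rewrite (enum_val_nth (0 : linear_dual F n)); apply: nth_map.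
  by rewrite size_tuple ltn_ord.
rewrite ffunE (trace_on_basis e_basis) => [|v]; last first.
  exact: cluster_module_stable.
rewrite [RHS]big_enum_val; apply: eq_bigr => i _.
set mu := enum_val i.
rewrite eE [X in coord e i X]regular_act_cluster_vector // linearZ /=.
rewrite mulrC; congr (_ * _).
have muO : (dual_act x mu : linear_dual F n) \in O.
  have /imsetP[g _ muE] : mu \in O := enum_valP i.
  by rewrite muE dual_actM; apply: imset_f.
have -> : cluster_vector theta (dual_act x mu) =
    e`_(enum_rank_in muO (dual_act x mu)).
  by rewrite eE enum_rankK_in.
rewrite coord_free ?(basis_free e_basis) // -(inj_eq enum_val_inj).
by rewrite enum_rankK_in.
Qed.

(** With X = x - 1 and h = 1 + Y, one has h X = X + (Y x - Y), hence
mu (h X) = mu X + (x mu - mu) Y: the sum over Y tests whether x fixes mu.  This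
trades the fixed-point condition in the character for an average over left
multiplications, which is what reveals the two-sided invariance. *)
Lemma sum_theta_mull mu x :
  \sum_h theta (mu (strict_upper_mull h (unitri_sub1 x))) =
  #|[set: unitri F n]|%:R *
    ((dual_act x mu == mu)%:R * theta (mu (unitri_sub1 x))).
Proof.
rewrite -subr_eq0 mulrA -sum_theta_form mulr_suml; apply: eq_bigr => h _.
rewrite -thetaD add_lfunE opp_lfunE dual_actE -linearN -!linearD /=.
congr (theta (mu _)); apply/val_inj => /=.
rewrite mulmxBr !mulmxBl !mulmx1 !mul1mx.
by apply/matrixP=> i j; rewrite !mxE; ring.
Qed.

(** Summing over pairs of group elements counts every form of the two-sided
orbit with the same multiplicity, and makes the invariance under both actions
a mere change of variables. *)
Definition biorbit_sum lam : group_algebra F n R :=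
  \sum_(p : unitri F n * unitri F n)
    cluster_vector theta (bidual_act p.1 p.2 lam).

Lemma biorbit_sum_bidual g h lam :
  biorbit_sum (bidual_act g h lam) = biorbit_sum lam.
Proof.
pose t (p : unitri F n * unitri F n) := ((g * p.1)%g, (p.2 * h)%g).
have t_inj : injective t.
  move=> [a b] [c d] E; congr (_, _).
    exact: mulgI (congr1 fst E).
  exact: mulIg (congr1 snd E).
rewrite [RHS](reindex_inj t_inj); apply: eq_bigr => p _.
by rewrite bidual_actM.
Qed.

Lemma dual_stab_gt0 lam : (0 < #|dual_stab lam|)%N.
Proof. by apply/card_gt0P; exists 1%g; rewrite inE dual_act1. Qed.

(** One of the two group averages removes the fixed-point condition, the other
unfolds the orbit, each of its points being hit once per stabilizer element. *)
Lemma biorbit_sumE lam :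
  biorbit_sum lam =
  (#|[set: unitri F n]|%:R * #|dual_stab lam|%:R) *:
    cluster_character theta lam.
Proof.
apply/ffunP=> x; rewrite ffunE cluster_character_orbit sum_ffunE.
rewrite -(pair_bigA _
  (fun g h => cluster_vector theta (bidual_act g h lam) x)) /=.
rewrite exchange_big /=.
pose G mu := (dual_act x mu == mu)%:R * theta (mu (unitri_sub1 x)).
transitivity (\sum_h #|[set: unitri F n]|%:R * G (dual_act h lam)).
  apply: eq_bigr => h _; rewrite -sum_theta_mull; apply: eq_bigr => g _.
  by rewrite ffunE bidual_actE dual_actE.
rewrite -mulr_sumr sum_dual_orbit.
by rewrite -[X in _ * X]mulr_natl [LHS]mulrA.
Qed.

Lemma cluster_characterE lam :
  cluster_character theta lam =
  (#|[set: unitri F n]|%:R * #|dual_stab lam|%:R)^-1 *: biorbit_sum lam.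
Proof.
rewrite biorbit_sumE scalerA mulVf ?scale1r //.
by rewrite mulf_neq0 ?card_unitri_neq0 // pnatr_eq0 -lt0n dual_stab_gt0.
Qed.

Lemma cluster_character_bidual g h lam :
  cluster_character theta (bidual_act g h lam) = cluster_character theta lam.
Proof.
by rewrite !cluster_characterE card_dual_stab_bidual biorbit_sum_bidual.
Qed.

Lemma biorbit_sum_mul lam g h x y :
  unitri_sub1 y = strict_upper_mulr h (strict_upper_mull g (unitri_sub1 x)) ->
  biorbit_sum lam y = biorbit_sum lam x.
Proof.
move=> xy; pose t (p : unitri F n * unitri F n) := ((p.1 * g)%g, (h * p.2)%g).
have t_inj : injective t.
  move=> [a b] [c d] E; congr (_, _).
    exact: mulIg (congr1 fst E).
  exact: mulgI (congr1 snd E).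
rewrite !sum_ffunE [RHS](reindex_inj t_inj); apply: eq_bigr => p _.
by rewrite !ffunE xy -bidual_actE bidual_actM.
Qed.

Lemma mem_conjugacy_cluster X y :
  reflect (exists g h,
     unitri_sub1 y = strict_upper_mulr h (strict_upper_mull g X))
    (y \in conjugacy_cluster X).
Proof.
rewrite inE; apply: (iffP imsetP) => [[_ /imset2P[g h _ _ ->] yE] | [g [h yE]]].
  by exists g, h; apply/val_inj; rewrite /= yE addrC addKr.
exists ((g : 'M_n) *m vsval X *m h); first exact: imset2_f.
have /(congr1 (@vsval _ _ _)) /= <- := yE.
by rewrite addrC subrK.
Qed.

Lemma cluster_character_cluster_function lam :
  cluster_character theta lam \in cluster_functions F n R.
Proof.
apply/cluster_functionsP=> X.
suff const z : z \in conjugacy_cluster X ->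
    cluster_character theta lam z =
    cluster_character theta lam (unitri_add1 X).
  by move=> x y Xx Xy; rewrite !const.
case/mem_conjugacy_cluster=> g [h zE].
rewrite cluster_characterE !ffunE; congr (_ *: _).
by apply: biorbit_sum_mul; rewrite unitri_add1K; apply: zE.
Qed.

(** Characters with a common v(mu) in their expansions come from the same
two-sided orbit, hence coincide; otherwise orthogonality is termwise. *)
Lemma inner_product_cluster_character lam mu :
  cluster_character theta lam != cluster_character theta mu ->
  inner_product (cluster_character theta lam) (cluster_character theta mu)
  = 0.
Proof.
move=> neq; rewrite !cluster_characterE inner_productZl inner_productZr.
rewrite inner_product_suml big1 ?mulr0 // => p _.
rewrite inner_product_sumr big1 // => q _.
rewrite inner_product_cluster_vector; case: eqVneq => // E.
case/eqP: neq.
by rewrite -(cluster_character_bidual p.1 p.2) E cluster_character_bidual.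
Qed.

(** At the identity every term of the two-sided sum equals 1. *)
Lemma cluster_character_neq0 lam : cluster_character theta lam != 0.
Proof.
apply/eqP=> chi0; have := biorbit_sumE lam; rewrite chi0 scaler0.
move/ffunP/(_ 1%g)/eqP; rewrite sum_ffunE ffunE.
have sub1 : unitri_sub1 (1%g : unitri F n) = 0.
  by apply/val_inj; rewrite /= subrr.
under eq_bigr do rewrite ffunE sub1 linear0 (theta0 thetaD theta_neq0).
rewrite sumr_const pnatr_eq0 eqn0Ngt => /card_gt0P[].
by exists (1%g, 1%g).
Qed.

Lemma cluster_vectors_span (f : group_algebra F n R) :
  f \in <<[seq cluster_vector theta lam | lam <- enum (linear_dual F n)]>>%VS.
Proof.
set s := map _ _.
suff /andP[/eqP-> _] : basis_of fullv s by rewrite memvf.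
rewrite basisEfree cluster_vectors_free ?enum_uniq ?subvf //=.
have -> : size s = #|linear_dual F n| by rewrite size_map cardE.
by rewrite dimvf -card_unitri /dim /= muln1.
Qed.

(** Up to the factor |G|^2, this is the projection onto cluster functions. *)
Definition cluster_average (f : group_algebra F n R) : group_algebra F n R :=
  [ffun x => \sum_(p : unitri F n * unitri F n)
    f (unitri_add1
         (strict_upper_mulr p.2 (strict_upper_mull p.1 (unitri_sub1 x))))].

Fact cluster_average_is_linear : linear cluster_average.
Proof.
move=> a f h; apply/ffunP=> x; rewrite !ffunE scaler_sumr -big_split.
by apply: eq_bigr => p _; rewrite !ffunE.
Qed.
HB.instance Definition _ :=
  GRing.isLinear.Build R[i] (group_algebra F n R) (group_algebra F n R) _
    cluster_average cluster_average_is_linear.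

Lemma cluster_average_vector lam :
  cluster_average (cluster_vector theta lam) = biorbit_sum lam.
Proof.
apply/ffunP=> x; rewrite ffunE sum_ffunE; apply: eq_bigr => p _.
by rewrite !ffunE unitri_add1K bidual_actE.
Qed.

Lemma cluster_average_id (f : group_algebra F n R) :
  f \in cluster_functions F n R ->
  cluster_average f = #|{: unitri F n * unitri F n}|%:R *: f.
Proof.
move/cluster_functionsP=> fC; apply/ffunP=> x; rewrite !ffunE.
(* Each of the averaged values is taken in the cluster of x. *)
transitivity (\sum_(p : unitri F n * unitri F n) f x); last first.
  by rewrite sumr_const [RHS]mulr_natl.
apply: eq_bigr => p _; apply: (fC (unitri_sub1 x)); apply/mem_conjugacy_cluster.
  by exists p.1, p.2; rewrite unitri_add1K.
exists 1%g, 1%g; apply/val_inj.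
by rewrite /= mul1mx mulmx1.
Qed.

Lemma cluster_function_span (f : group_algebra F n R) :
  f \in cluster_functions F n R -> f \in <<cluster_characters n theta>>%VS.
Proof.
move/cluster_average_id=> avg_f.
have N_neq0 : #|{: unitri F n * unitri F n}|%:R != 0 :> R[i].
  by rewrite pnatr_eq0 -lt0n; apply/card_gt0P; exists (1%g, 1%g).
rewrite -[f](scalerK N_neq0) -avg_f; apply: memvZ.
set s := [seq cluster_vector theta lam | lam <- enum (linear_dual F n)].
have /(@coord_span _ _ _ (in_tuple s)) -> := cluster_vectors_span f.
rewrite linear_sum; apply: memv_suml => i _; rewrite linearZ; apply: memvZ.
have /mapP[lam _ ->] : (in_tuple s)`_i \in s by apply: mem_nth.
rewrite [X in X \in _]cluster_average_vector biorbit_sumE.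
by apply/memvZ/memv_span/cluster_charactersP; exists lam.
Qed.

End ClusterCharacterTheory.

Theorem corollary2p8 (R : realType) (F : finFieldType) (n : nat)
    (n_gt0 : (0 < n)%N) (theta : F -> R[i])
    (thetaD : forall x y : F, theta (x + y) = theta x * theta y)
    (theta_neq0 : forall x : F, theta x != 0)
    (theta_nontrivial : exists x : F, theta x != 1) :
  basis_of (cluster_functions F n R) (cluster_characters n theta) /\
  {in cluster_characters n theta &, forall f h : group_algebra F n R,
     f != h -> inner_product f h = 0}.
Proof.
have orth : {in cluster_characters n theta &, forall f h : group_algebra F n R,
    f != h -> inner_product f h = 0}.
  move=> _ _ /cluster_charactersP[lam ->] /cluster_charactersP[mu ->].
  exact: inner_product_cluster_character.
split=> //; rewrite /basis_of eqEsubv; apply/andP; split; last first.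
  apply: orthogonal_free orth; first exact: undup_uniq.
  apply/cluster_charactersP=> -[lam /esym/eqP].
  exact/negP/cluster_character_neq0.
apply/andP; split.
  apply/span_subvP=> _ /cluster_charactersP[lam ->].
  exact: cluster_character_cluster_function.
by apply/subvP=> f; apply: cluster_function_span.
Qed.
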